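(* Let $g$ be an element of $\mathrm{PSL}(2,\mathbb Z)=\langle a,b\mid a^2,b^3\rangle$. Then $g$ is a generalised $3$-torsion element if any of the following holds: (1) $g$ is an elliptic element of order $3$; (2) $g$ is a parabolic element conjugate to one of $(ab)^{\pm 2}$; (3) $g$ is a hyperbolic element conjugate to an element which is a product of two elements of order $3$.
   Context: An element $g$ of a group $G$ is a generalised $n$-torsion element if there exist $k_1,\dots,k_n\in G$ with $k_1gk_1^{-1}k_2gk_2^{-1}\cdots k_ngk_n^{-1}=\mathrm{Id}$. The generators $a$ (of order 2) and $b$ (of order 3) of $\mathrm{PSL}(2,\mathbb Z)$ are chosen so that $(ab)^n$ is represented by the matrix $\begin{bmatrix}1&n\\0&1\end{bmatrix}$. *)

(* Defs.v *)
From HB Require Import structures.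
From mathcomp Require Import all_boot all_order all_algebra.

Set Implicit Arguments.
Unset Strict Implicit.
Unset Printing Implicit Defensive.

Import Order.TTheory GRing.Theory Num.Theory.
Local Open Scope ring_scope.
Local Open Scope quotient_scope.

Section GroupNotions.
Local Open Scope group_scope.
Variable G : groupType.
Implicit Types (g h : G) (n : nat).

Definition generalised_torsion n g : Prop :=
  exists k : 'I_n -> G, \prod_(i < n) (k i * g * (k i)^-1) = 1.

Definition has_order g n : Prop :=
  [/\ (0 < n)%N, g ^+ n = 1 & forall m, (0 < m < n)%N -> g ^+ m <> 1].

Definition conjugate g h : Prop := exists x : G, g = x * h * x^-1.

Inductive generated (S : G -> Prop) : G -> Prop :=
| generated_mem g : S g -> generated S g
| generated_one : generated S 1
| generated_mul g h : generated S g -> generated S h -> generated S (g * h)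
| generated_inv g : generated S g -> generated S g^-1.

End GroupNotions.

Record SL2Z := MkSL2Z { slmx :> 'M[int]_2; slmxP : \det slmx == 1 }.

HB.instance Definition _ := [isSub for slmx].
HB.instance Definition _ := [Choice of SL2Z by <:].

Fact sl_one_subproof : \det (1%:M : 'M[int]_2) == 1.
Proof. by rewrite det1. Qed.

Fact sl_mul_subproof (A B : SL2Z) : \det (slmx A *m slmx B) == 1.
Proof. by rewrite det_mulmx (eqP (slmxP A)) (eqP (slmxP B)) mulr1. Qed.

Fact sl_inv_subproof (A : SL2Z) : \det (invmx (slmx A)) == 1.
Proof. by rewrite det_inv (eqP (slmxP A)) invr1. Qed.

Fact sl_opp_subproof (A : SL2Z) : \det (- slmx A) == 1.
Proof. by rewrite -scaleN1r detZ (eqP (slmxP A)) mulr1 sqrrN expr1n. Qed.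

Definition sl_one := MkSL2Z sl_one_subproof.
Definition sl_mul A B := MkSL2Z (sl_mul_subproof A B).
Definition sl_inv A := MkSL2Z (sl_inv_subproof A).
Definition sl_opp A := MkSL2Z (sl_opp_subproof A).

Lemma slmx_unit (A : SL2Z) : slmx A \in unitmx.
Proof. by rewrite unitmxE (eqP (slmxP A)) unitr1. Qed.

Fact sl_mulA : associative sl_mul.
Proof. by move=> A B C; apply: val_inj; rewrite /= mulmxA. Qed.
Fact sl_mul1 : left_id sl_one sl_mul.
Proof. by move=> A; apply: val_inj; rewrite /= mul1mx. Qed.
Fact sl_mulr1 : right_id sl_one sl_mul.
Proof. by move=> A; apply: val_inj; rewrite /= mulmx1. Qed.
Fact sl_mulV : left_inverse sl_one sl_inv sl_mul.
Proof. by move=> A; apply: val_inj; rewrite /= mulVmx ?slmx_unit. Qed.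
Fact sl_mulrV : right_inverse sl_one sl_inv sl_mul.
Proof. by move=> A; apply: val_inj; rewrite /= mulmxV ?slmx_unit. Qed.

HB.instance Definition _ := isGroup.Build SL2Z
  sl_mulA sl_mul1 sl_mulr1 sl_mulV sl_mulrV.

Definition sl_eqv (A B : SL2Z) : bool := (A == B) || (A == sl_opp B).

Lemma sl_oppK : involutive sl_opp.
Proof. by move=> A; apply: val_inj; rewrite /= opprK. Qed.

Fact sl_eqv_refl : reflexive sl_eqv.
Proof. by move=> A; rewrite /sl_eqv eqxx. Qed.
Fact sl_eqv_sym : symmetric sl_eqv.
Proof.
by move=> A B; rewrite /sl_eqv [A == B]eq_sym -(can_eq sl_oppK A) sl_oppK [_ == B]eq_sym.
Qed.
Fact sl_eqv_trans : transitive sl_eqv.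
Proof.
move=> B A C /orP[] /eqP-> // /orP[] /eqP->; rewrite /sl_eqv ?sl_oppK eqxx //.
by rewrite orbT.
Qed.

Canonical sl_eqv_equiv := EquivRel sl_eqv sl_eqv_refl sl_eqv_sym sl_eqv_trans.

Definition PSL2Z := {eq_quot sl_eqv}.
HB.instance Definition _ := Choice.on PSL2Z.
HB.instance Definition _ := EqQuotient.on PSL2Z.

Lemma psl_piP (A B : SL2Z) :
  reflect (A = B \/ A = sl_opp B) (\pi_PSL2Z A == \pi_PSL2Z B).
Proof. by rewrite eqmodE; apply: (iffP orP) => -[/eqP|/eqP]; auto. Qed.

Definition psl_one : PSL2Z := \pi_PSL2Z sl_one.
Definition psl_mul (g h : PSL2Z) : PSL2Z := \pi_PSL2Z (sl_mul (repr g) (repr h)).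
Definition psl_inv (g : PSL2Z) : PSL2Z := \pi_PSL2Z (sl_inv (repr g)).

Lemma psl_mul_pi A B : psl_mul (\pi_PSL2Z A) (\pi_PSL2Z B) = \pi_PSL2Z (sl_mul A B).
Proof.
apply/eqP/psl_piP.
have /eqP/psl_piP[->|->] := reprK (\pi_PSL2Z A);
have /eqP/psl_piP[->|->] := reprK (\pi_PSL2Z B).
- by left.
- by right; apply: val_inj; rewrite /= mulmxN.
- by right; apply: val_inj; rewrite /= mulNmx.
- by left; apply: val_inj; rewrite /= mulNmx mulmxN opprK.
Qed.

Lemma psl_inv_pi A : psl_inv (\pi_PSL2Z A) = \pi_PSL2Z (sl_inv A).
Proof.
apply/eqP/psl_piP; have /eqP/psl_piP[->|->] := reprK (\pi_PSL2Z A); first by left.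
have uN : - slmx A \in unitmx := slmx_unit (sl_opp A).
right; apply: val_inj => /=; apply: (can_inj (mulmxK uN)).
by rewrite mulVmx // mulNmx mulmxN opprK mulVmx ?slmx_unit.
Qed.

Fact psl_mulA : associative psl_mul.
Proof.
elim/quotW=> A; elim/quotW=> B; elim/quotW=> C.
by rewrite (psl_mul_pi B C) (psl_mul_pi A B) (psl_mul_pi A) (psl_mul_pi _ C) sl_mulA.
Qed.
Fact psl_mul1 : left_id psl_one psl_mul.
Proof. by elim/quotW=> A; rewrite psl_mul_pi sl_mul1. Qed.
Fact psl_mulr1 : right_id psl_one psl_mul.
Proof. by elim/quotW=> A; rewrite psl_mul_pi sl_mulr1. Qed.
Fact psl_mulV : left_inverse psl_one psl_inv psl_mul.
Proof. by elim/quotW=> A; rewrite psl_inv_pi psl_mul_pi sl_mulV. Qed.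
Fact psl_mulrV : right_inverse psl_one psl_inv psl_mul.
Proof. by elim/quotW=> A; rewrite psl_inv_pi psl_mul_pi sl_mulrV. Qed.

HB.instance Definition _ := isGroup.Build PSL2Z
  psl_mulA psl_mul1 psl_mulr1 psl_mulV psl_mulrV.

Definition represents (M : 'M[int]_2) (g : PSL2Z) : Prop :=
  exists2 A : SL2Z, slmx A = M & \pi_PSL2Z A = g.

(* The trace is defined on PSL(2,Z) only up to sign. *)
Definition abs_trace (g : PSL2Z) : int := `|\tr (slmx (repr g))|.

Lemma abs_trace_represents M g : represents M g -> abs_trace g = `|\tr M|.
Proof.
case=> A <- <-; rewrite /abs_trace.
by have /eqP/psl_piP[->|->] := reprK (\pi_PSL2Z A); rewrite //= raddfN normrN.
Qed.

Definition elliptic (g : PSL2Z) : Prop := abs_trace g < 2.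
Definition parabolic (g : PSL2Z) : Prop := abs_trace g = 2 /\ g <> 1%g.
Definition hyperbolic (g : PSL2Z) : Prop := 2 < abs_trace g.

Definition translation_mx (n : int) : 'M[int]_2 :=
  \matrix_(i, j) (if i == j then 1 else if (i < j)%N then n else 0).

(* These conditions determine (a, b) up to simultaneous conjugation by a power
   of a * b. *)
Definition standard_generators (a b : PSL2Z) : Prop :=
  [/\ has_order a 2, has_order b 3,
      (forall g, generated (fun x => x = a \/ x = b) g)
    & forall n : nat, represents (translation_mx n%:Z) ((a * b) ^+ n)%g].

(* Main.v *)
(* If u^3 = v^3 = 1 then uv . vu . u^-1 (vu) u = u v^3 u^2 = 1, and vu is
   conjugate to uv, so uv is a generalised 3-torsion element of any group.
   The parabolic elements are of this form: since a^2 = 1,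
   (ab)^2 = (a b a^-1) b and (ab)^-2 = b^-1 (a b^-1 a^-1). *)
Require Import Defs.
From mathcomp Require Import all_boot all_order all_algebra.

Local Open Scope group_scope.

Lemma generalised_torsion_expg (G : groupType) (n : nat) (g : G) :
  g ^+ n = 1 -> generalised_torsion n g.
Proof.
move=> gn1; exists (fun=> 1); under eq_bigr => i _ do rewrite invg1 mul1g mulg1.
by rewrite prodg_const card_ord.
Qed.

(** Absorbing [x^-1] into every conjugator cancels the conjugation by [x], factor by factor. *)
Lemma generalised_torsion_conjugate (G : groupType) (n : nat) (g h : G) :
  conjugate g h -> generalised_torsion n h -> generalised_torsion n g.
Proof.
move=> [x ->] [k k1]; exists (fun i => k i * x^-1); rewrite -[RHS]k1.
by apply: eq_bigr => i _; rewrite invgM invgK !mulgA !mulgVK.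
Qed.

Lemma generalised_torsion3_mul (G : groupType) (u v : G) :
  u ^+ 3 = 1 -> v ^+ 3 = 1 -> generalised_torsion 3 (u * v).
Proof.
(* Conjugation by [v] turns [u * v] into [v * u]; a further conjugation by [u^-1] gives the third
   factor. *)
move=> u3 v3; exists (fun i => nth 1 [:: 1; v; u^-1 * v] i).
rewrite !big_ord_recr big_ord0 /= !mul1g invg1 mulg1 invgM invgK.
rewrite !mulgA mulgK mulgK mulgK.
(* After the three cancellations the word is [u * v * v * v * u * u]. *)
have -> : u * v * v * v = u by rewrite -!mulgA -expg2 -expgS v3 mulg1.
by rewrite -mulgA -expg2 -expgS.
Qed.

Lemma expg_conjugate1 (G : groupType) (n : nat) (x y : G) :
  y ^+ n = 1 -> (x * y * x^-1) ^+ n = 1.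
Proof.
move=> yn1; have -> : x * y * x^-1 = y ^ x^-1 by rewrite conjgE invgK mulgA.
by rewrite -conjXg yn1 conj1g.
Qed.

Theorem theorem5p5 (a b : PSL2Z) (hab : standard_generators a b) (g : PSL2Z)
  (hg : (elliptic g /\ has_order g 3)
     \/ (parabolic g /\
         (conjugate g ((a * b) ^+ 2)%g \/ conjugate g ((a * b) ^- 2)%g))
     \/ (hyperbolic g /\
         exists u v : PSL2Z,
           [/\ has_order u 3, has_order v 3 & conjugate g (u * v)%g])) :
  generalised_torsion 3 g.
Proof.
case: hab => -[_ a2 _] [_ b3 _] _ _.
have aV : a^-1 = a by apply: (mulgI a); rewrite mulgV -expg2.
(* For [(ab)^-2], both factors of the product are conjugates of [b^-1]. *)
have bV3 : b^-1 ^+ 3 = 1 by rewrite expVgn b3 invg1.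
case: hg => [[_ [_ g3 _]]|[[_ [gab|gab]]|[_ [u [v [[_ u3 _] [_ v3 _] guv]]]]]].
- exact: generalised_torsion_expg.
- apply: generalised_torsion_conjugate gab _.
  have -> : (a * b) ^+ 2 = (a * b * a^-1) * b by rewrite aV expg2 !mulgA.
  by apply: generalised_torsion3_mul => //; apply: expg_conjugate1.
- apply: generalised_torsion_conjugate gab _.
  have -> : (a * b) ^- 2 = b^-1 * (a * b^-1 * a^-1).
    by rewrite expg2 !invgM aV !mulgA.
  by apply: generalised_torsion3_mul => //; apply: expg_conjugate1.
- apply: generalised_torsion_conjugate guv _.
  exact: generalised_torsion3_mul.
Qed.
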